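(* Let $k,t,n$ be positive integers with $1\le t\le k$ and $2k-t\le n$. Then there exists a map $f:\mathcal{M}(n,k,t)\to\mathcal{M}(n,k,t)$ such that for every $\mathcal{F}\in\mathcal{M}(n,k,t)$: (i) $|\mathcal{F}|=|f(\mathcal{F})|$; (ii) $M(n,1)$ is a $t$-kernel for $f(\mathcal{F})$, i.e. $|F_1\cap F_2\cap M(n,1)|\ge t$ for all $F_1,F_2\in f(\mathcal{F})$ (equivalently, for all $F_1,F_2\in f(\mathcal F)$ there are at least $t$ indices $i\in[n]$ with $m(i,F_1)\ge 1$ and $m(i,F_2)\ge 1$); (iii) $\max\{m(i,F): i\in[n],\,F\in\mathcal{F}\}\ \ge\ \max\{m(i,F): i\in[n],\,F\in f(\mathcal{F})\}$.
   Context: $[n]=\{1,\dots,n\}$. A multiset $F$ of $[n]$ is a sequence $(m(1,F),\dots,m(n,F))$ of non-negative integers; $m(i,F)$ is the multiplicity of $i$ in $F$, and the cardinality is $|F|=\sum_{i=1}^n m(i,F)$. $F$ is a $k$-multiset if $|F|=k$. The intersection $F\cap G$ of two multisets is the multiset with multiplicities $\min\{m(i,F),m(i,G)\}$. Equivalently, a $k$-multiset is identified with the $k$-element set $\{(i,s): 1\le i\le n,\ 1\le s\le m(i,F)\}$, and then intersection is the set intersection; $M(n,\ell)=\{(i,j):1\le i\le n,\ 1\le j\le \ell\}$, so $M(n,1)$ is the multiset in which every element of $[n]$ has multiplicity $1$. A family $\mathcal{F}$ of multisets is $t$-intersecting if $|F_1\cap F_2|\ge t$ for all $F_1,F_2\in\mathcal{F}$.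 $\mathcal{M}(n,k,t)$ is the set of all $t$-intersecting families (sets) of $k$-multisets of $[n]$. A multiset $T$ is a $t$-kernel of a family $\mathcal{F}$ if $|F_1\cap F_2\cap T|\ge t$ for all $F_1,F_2\in\mathcal{F}$. The maximum of the empty set is taken to be $0$ (relevant only for the empty family). *)

(* Defs.v *)
From mathcomp Require Import all_boot.
From mathcomp Require Import finmap multiset.

Set Implicit Arguments.
Unset Strict Implicit.
Unset Printing Implicit Defensive.

Local Open Scope fset_scope.
Local Open Scope mset_scope.
Local Open Scope nat_scope.

(* The ground set [n] = {1, ..., n} is represented by 'I_n = {0, ..., n - 1};
   the multiplicity m(i, F) is F i. *)

Definition mcard n (F : {mset 'I_n}) : nat := \sum_(i < n) F i.

Lemma mcardE n (F : {mset 'I_n}) : mcard F = size F.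
Proof.
rewrite size_mset /mcard (bigID (mem (finsupp F))) /= [X in _ + X]big1 => [|i].
  rewrite addn0 -big_filter; apply/perm_big/uniq_perm => [||i].
  - exact/filter_uniq/index_enum_uniq.
  - exact: fset_uniq.
  - by rewrite mem_filter mem_index_enum andbT.
by rewrite memNfinsupp => /eqP.
Qed.

(* M(n, l): every element of [n] has multiplicity l. *)
Definition Mset (n l : nat) : {mset 'I_n} := [fsfun i in [fset j in 'I_n] => l].

Lemma MsetE n l i : Mset n l i = l.
Proof. by rewrite fsfunE !inE. Qed.

(* all2rel quantifies over all pairs of members, equal ones included. *)
Definition t_intersecting n t (FF : {fset {mset 'I_n}}) : bool :=
  all2rel (fun F1 F2 => t <= mcard (F1 `&` F2)) FF.

Definition t_kernel n t (T : {mset 'I_n}) (FF : {fset {mset 'I_n}}) : bool :=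
  all2rel (fun F1 F2 => t <= mcard (F1 `&` F2 `&` T)) FF.

Definition is_t_int_family n (k t : nat) (FF : {fset {mset 'I_n}}) : bool :=
  all (fun F => mcard F == k) FF && t_intersecting t FF.

(* The set M(n, k, t). There are only finitely many k-multisets of [n], so every
   family of them is an {fset _}; membership is a boolean predicate, so elements
   of the sigma type are determined by the family. *)
Definition t_int_family (n k t : nat) : Type :=
  {FF : {fset {mset 'I_n}} | is_t_int_family k t FF}.

(* The empty maximum is 0. *)
Definition max_mult n (FF : {fset {mset 'I_n}}) : nat :=
  \max_(F <- FF) \max_(i < n) F i.

(* Main.v *)
Require Import Defs.
From mathcomp Require Import all_boot.
From mathcomp Require Import finmap multiset.
From mathcomp Require Import zify.

Set Implicit Arguments.
Unset Strict Implicit.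
Unset Printing Implicit Defensive.

Local Open Scope fset_scope.
Local Open Scope mset_scope.
Local Open Scope nat_scope.

(** The proof is a compression argument. Fix two indices i and j. Multisets
    that agree outside i and j and have the same total s = F i + F j form a
    fiber, which is a set of values a = F i in [0, s]. Compression replaces
    each fiber by the run of equally many values around s / 2, always leaning
    the same way when parity forces a choice ([compression]).

    Compression preserves the t-intersecting property. For values a in [0, s]
    and b in [0, s'] the two multisets share
    min (s, s', s - a + b, s' - b + a) elements on {i, j}. If A and B are two
    fibers, adding the last two terms for the pairs (max A, min B) and
    (min A, max B) bounds twice the guaranteed intersection by
    s + s' - (|A| - 1) - (|B| - 1), and centred runs reach this bound up to
    rounding ([squeeze_meet]).

    Compression moves every multiset individually towards balance between i
    and j, so no multiplicity exceeds the old maximum and the energy, the sum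
    of the squares of all multiplicities over the family, does not increase.
    Hence it suffices that a family for which M(n, 1) is not a t-kernel has a
    compression of strictly smaller energy ([energy_descent]). Take F and G
    with fewer than t common support points. Then some i has multiplicity at
    least 2 in both, and since 2k - t <= n some j belongs to neither. In the
    fiber of F for (i, j), F sits at the extreme value s >= 2. If the value 1
    is missing from the fiber, compression strictly pulls F off the extreme.
    If it is present, replacing F by that multiset leaves the common support
    with G unchanged and makes the intersection with G smaller, so this case
    cannot recur forever. *)

(** * Centring a set of values in an interval *)

(** Orders [0, s] by distance to s / 2, the larger of two equidistant values
    first. The enumeration starts at the ceiling of s / 2 and alternates
    sides, so its initial segments are the centred runs. *)
Definition rank (s a : nat) : nat :=
  if s < a.*2 then (a.*2 - s).-1 else s - a.*2.

(** The inverse of [rank s] on [0, s]: [rank] has the parity of s exactly on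
    the values at most s / 2. *)
Definition unrank (s r : nat) : nat :=
  if odd (s + r) then (s + r).+1./2 else (s - r)./2.

Lemma rank_le s a : a <= s -> rank s a <= s.
Proof. by rewrite /rank; case: ifP; lia. Qed.

Lemma unrank_le s r : r <= s -> unrank s r <= s.
Proof. by rewrite /unrank; case: ifP; lia. Qed.

Lemma unrankK s r : r <= s -> rank s (unrank s r) = r.
Proof. by rewrite /unrank /rank; do 2 case: ifP; lia. Qed.

Lemma rank_inj s : {in [pred a | a <= s] &, injective (rank s)}.
Proof. by move=> a b; rewrite !inE /rank; do 2 case: ifP; lia. Qed.

Lemma count_rank_lt s r :
  count (fun b => rank s b < r) (iota 0 s.+1) <= r.
Proof.
rewrite -size_filter -(size_map (rank s)) -[leqRHS](size_iota 0).
apply: uniq_leq_size => [|_ /mapP[b + ->]].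
  rewrite map_inj_in_uniq ?filter_uniq ?iota_uniq // => a b.
  rewrite !mem_filter !mem_iota => /andP[_ ha] /andP[_ hb].
  by apply: rank_inj; rewrite inE; lia.
by rewrite mem_filter !mem_iota => /andP[].
Qed.

Definition position (s : nat) (P : pred nat) (a : nat) : nat :=
  count (fun b => P b && (rank s b < rank s a)) (iota 0 s.+1).

(** Sends the r-th closest element of the set P to the r-th closest element of
    [0, s]: the image of P is a centred run, and, unlike an order-preserving
    map onto that run, this one moves no element away from the centre. *)
Definition squeeze (s : nat) (P : pred nat) (a : nat) : nat :=
  unrank s (position s P a).

Lemma position_le_rank s P a : position s P a <= rank s a.
Proof.
apply: leq_trans (count_rank_lt s _).
by apply: sub_count => b /andP[].
Qed.

Lemma count_lt (T : eqType) (p q : pred T) (l : seq T) x :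
  subpred p q -> x \in l -> ~~ p x -> q x -> count p l < count q l.
Proof.
move=> pq xl px qx.
have disj : count (predI (pred1 x) p) l = 0.
  by apply/eqP; rewrite eqn0Ngt -has_count; apply/hasPn => y _ /=;
    case: eqP => // ->.
have sub : subpred (predU (pred1 x) p) q.
  by move=> y /= /orP[/eqP-> | /pq].
have := sub_count sub l; have := count_predUI (pred1 x) p l.
have : 0 < count_mem x l by rewrite -has_count has_pred1.
by rewrite disj; lia.
Qed.

Lemma squeeze_le s P a : a <= s -> squeeze s P a <= s.
Proof.
move=> le_as; apply/unrank_le/(leq_trans (position_le_rank _ _ _)).
exact: rank_le.
Qed.

Lemma rank_squeeze s P a : a <= s -> rank s (squeeze s P a) = position s P a.
Proof.
move=> le_as; apply/unrankK/(leq_trans (position_le_rank _ _ _)).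
exact: rank_le.
Qed.

Lemma position_lt s (P : pred nat) a : a <= s -> P a ->
  position s P a < count P (iota 0 s.+1).
Proof.
move=> le_as Pa; apply: (@count_lt _ _ _ _ a) => [b /andP[] //| | |//].
  by rewrite mem_iota; lia.
by rewrite ltnn andbF.
Qed.

Lemma position_inj s (P : pred nat) :
  {in [pred a | (a <= s) && P a] &, injective (position s P)}.
Proof.
have mono a b : a <= s -> P a -> rank s a < rank s b ->
    position s P a < position s P b.
  move=> le_as Pa lt_ab; apply: (@count_lt _ _ _ _ a).
  - by move=> c /andP[-> /= /ltn_trans->].
  - by rewrite mem_iota; lia.
  - by rewrite ltnn andbF.
  - by rewrite Pa lt_ab.
move=> a b /andP[/= sa Pa] /andP[/= sb Pb] eq_pos.
apply: (@rank_inj s) => //; apply/eqP; case: ltngtP => // lt_ab.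
  by have := mono a b sa Pa lt_ab; rewrite eq_pos ltnn.
by have := mono b a sb Pb lt_ab; rewrite eq_pos ltnn.
Qed.

Lemma squeeze_inj s (P : pred nat) :
  {in [pred a | (a <= s) && P a] &, injective (squeeze s P)}.
Proof.
move=> a b ha hb eq_ab; apply: (@position_inj s P) => //.
case/andP: ha hb => /= sa _ /andP[/= sb _].
by rewrite -!rank_squeeze // eq_ab.
Qed.

(** Since [position] is at most [rank], a value is never moved further from
    the centre. *)
Lemma squeeze_max s P a : a <= s ->
  maxn (squeeze s P a) (s - squeeze s P a) <= maxn a (s - a).
Proof.
move=> le_as; have := position_le_rank s P a; rewrite -rank_squeeze //.
by have := squeeze_le P le_as; rewrite /rank; do 2 case: ifP; lia.
Qed.

Lemma squeeze_sqr s P a : a <= s ->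
  squeeze s P a ^ 2 + (s - squeeze s P a) ^ 2 <= a ^ 2 + (s - a) ^ 2.
Proof.
move=> le_as; have := squeeze_max P le_as; have := squeeze_le P le_as.
by move: (squeeze s P a) => b le_bs; nia.
Qed.

(** All values preceding s in the order, apart from the absent 1, number at
    most s - 2, so s moves strictly inside, where the sum of squares drops. *)
Lemma squeeze_sqr_lt s (P : pred nat) : 1 < s -> ~~ P 1 ->
  squeeze s P s ^ 2 + (s - squeeze s P s) ^ 2 < s ^ 2.
Proof.
move=> s_gt1 P1.
have : position s P s < count (fun b => rank s b < rank s s) (iota 0 s.+1).
  apply: (@count_lt _ _ _ _ 1) => [b /andP[] //| | | ].
  - by rewrite mem_iota; lia.
  - by rewrite (negPf P1).
  - by rewrite /rank; do 2 case: ifP; lia.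
move=> /leq_trans/(_ (count_rank_lt _ _)); rewrite -rank_squeeze //.
have := squeeze_le P (leqnn s); move: (squeeze s P s) => b le_bs.
rewrite /rank => lt_b; have [b0 bs] : 0 < b /\ b < s.
  by move: lt_b; do 2 case: ifP; lia.
by nia.
Qed.

(** The image lies in the centred run of as many values as P has; with
    doubled values the bounds need no rounding. *)
Lemma squeeze_bounds s (P : pred nat) a : a <= s -> P a ->
  s < (squeeze s P a).*2 + count P (iota 0 s.+1) /\
  (squeeze s P a).*2 <= s + count P (iota 0 s.+1).
Proof.
move=> le_as Pa; have := position_lt le_as Pa; rewrite -rank_squeeze //.
by rewrite /rank; case: ifP; lia.
Qed.

(** P fits between its minimum and its maximum. *)
Lemma count_span s (P : pred nat) a : a <= s -> P a ->
  exists lo hi, [/\ lo <= s, hi <= s, P lo, P hi &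
    count P (iota 0 s.+1) + lo <= hi.+1].
Proof.
move=> le_as Pa.
have exP : exists b, (b <= s) && P b by exists a; rewrite le_as.
have leP b : (b <= s) && P b -> b <= s by case/andP.
case: (ex_minnP exP) => lo /andP[lo_s Plo] lo_min.
case: (ex_maxnP exP leP) => hi /andP[hi_s Phi] hi_max.
exists lo, hi; split=> //.
have : count P (iota 0 s.+1) <= hi.+1 - lo.
  rewrite -size_filter -[leqRHS](size_iota lo).
  apply: uniq_leq_size => [|b]; first by rewrite filter_uniq ?iota_uniq.
  rewrite mem_filter !mem_iota => /andP[Pb]; rewrite add0n ltnS => /= le_bs.
  have := lo_min b; have := hi_max b; rewrite le_bs Pb => /(_ isT) ? /(_ isT) ?.
  by lia.
have := lo_min hi; rewrite hi_s Phi => /(_ isT); by lia.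
Qed.

(** The hypothesis at the extreme elements of P and Q bounds the sum of their
    sizes; [squeeze_bounds] turns this into a lower bound t - 1/2 for the
    conclusion, whose right-hand side is an integer. The term r stands for the
    part of the intersection outside the two coordinates. *)
Lemma squeeze_meet s s' (P Q : pred nat) t r :
  (forall a b, a <= s -> b <= s' -> P a -> Q b ->
     t <= minn a b + minn (s - a) (s' - b) + r) ->
  forall a b, a <= s -> b <= s' -> P a -> Q b ->
    t <= minn (squeeze s P a) (squeeze s' Q b)
         + minn (s - squeeze s P a) (s' - squeeze s' Q b) + r.
Proof.
move=> meet a b le_as le_bs Pa Qb.
have [lo [hi [lo_s hi_s Plo Phi span]]] := count_span le_as Pa.
have [lo' [hi' [lo_s' hi_s' Qlo Qhi span']]] := count_span le_bs Qb.
have := meet _ _ hi_s lo_s' Phi Qlo; have := meet _ _ lo_s hi_s' Plo Qhi.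
have := squeeze_bounds le_as Pa; have := squeeze_bounds le_bs Qb.
have := squeeze_le P le_as; have := squeeze_le Q le_bs.
by lia.
Qed.

Lemma eq_squeeze s (P Q : pred nat) a : P =1 Q -> squeeze s P a = squeeze s Q a.
Proof.
by move=> PQ; congr unrank; apply: eq_count => b; rewrite PQ.
Qed.

(** * Compressing a family on two coordinates *)

Definition mset_of n (h : 'I_n -> nat) : {mset 'I_n} :=
  [fsfun x in [fset y in 'I_n] => h x].

Lemma mset_ofE n (h : 'I_n -> nat) x : mset_of h x = h x.
Proof. by rewrite fsfunE !inE. Qed.

Definition redistribute n (i j : 'I_n) (a : nat) (F : {mset 'I_n}) :=
  mset_of (fun x =>
    if x == i then a else if x == j then F i + F j - a else F x).

Section Redistribute.
Variables (n : nat) (i j : 'I_n).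
Hypothesis neq_ij : i != j.
Implicit Types F G : {mset 'I_n}.

Lemma redistribute_l a F : redistribute i j a F i = a.
Proof. by rewrite mset_ofE eqxx. Qed.

Lemma redistribute_r a F : redistribute i j a F j = F i + F j - a.
Proof. by rewrite mset_ofE eq_sym (negPf neq_ij) eqxx. Qed.

Lemma redistribute_other a F x :
  x != i -> x != j -> redistribute i j a F x = F x.
Proof. by rewrite mset_ofE => /negPf-> /negPf->. Qed.

Lemma redistribute_id F : redistribute i j (F i) F = F.
Proof.
apply/msetP => x; rewrite mset_ofE.
by case: eqP => [->|_] //; case: eqP => [->|_] //; rewrite addKn.
Qed.

Lemma redistribute_twice a b F : a <= F i + F j ->
  redistribute i j b (redistribute i j a F) = redistribute i j b F.
Proof.
move=> le_a; apply/msetP => x; rewrite [LHS]mset_ofE [RHS]mset_ofE.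
rewrite redistribute_l redistribute_r subnKC //.
by case: eqVneq => // xi; case: eqVneq => // xj; rewrite redistribute_other.
Qed.

Lemma big_split2 (h : 'I_n -> nat) :
  \sum_x h x = h i + h j + \sum_(x | (x != i) && (x != j)) h x.
Proof. by rewrite (bigD1 i) //= (bigD1 j) ?addnA // eq_sym. Qed.

Lemma mcard_redistribute a F : a <= F i + F j ->
  mcard (redistribute i j a F) = mcard F.
Proof.
move=> le_a; rewrite /mcard !big_split2 redistribute_l redistribute_r subnKC //.
by congr (_ + _); apply: eq_bigr => x /andP[xi xj]; rewrite redistribute_other.
Qed.

Lemma mcard_meet_redistribute a b F G :
  mcard (redistribute i j a F `&` redistribute i j b G)%mset =
  minn a b + minn (F i + F j - a) (G i + G j - b)
  + \sum_(x | (x != i) && (x != j)) minn (F x) (G x).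
Proof.
rewrite /mcard big_split2 !msetE2 !redistribute_l !redistribute_r.
congr (_ + _); apply: eq_bigr => x /andP[xi xj].
by rewrite msetE2 !redistribute_other.
Qed.

Variable FF : {fset {mset 'I_n}}.

(** The fiber through F, each member standing for its value at i; this reading
    is for b <= F i + F j, where the truncated subtraction is exact. *)
Definition fiber F : pred nat := fun b => redistribute i j b F \in FF.

Definition compress F : {mset 'I_n} :=
  redistribute i j (squeeze (F i + F j) (fiber F) (F i)) F.

Definition compression : {fset {mset 'I_n}} := [fset compress F | F in FF].

Lemma fiber_id F : F \in FF -> fiber F (F i).
Proof. by rewrite /fiber redistribute_id. Qed.

(** The image of F determines the fiber of F, and [squeeze] is injective on
    each fiber. *)
Lemma compress_inj : {in FF &, injective compress}.
Proof.
move=> F G FFF GFF eq_FG.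
have sF := squeeze_le (fiber F) (leq_addr (F j) (F i)).
have sG := squeeze_le (fiber G) (leq_addr (G j) (G i)).
have eq_i : squeeze (F i + F j) (fiber F) (F i)
          = squeeze (G i + G j) (fiber G) (G i).
  by have := congr1 (fun H : {mset 'I_n} => H i) eq_FG;
    rewrite !redistribute_l.
have eq_s : F i + F j = G i + G j.
  have := congr1 (fun H : {mset 'I_n} => H j) eq_FG.
  rewrite !redistribute_r => eq_j.
  by rewrite -[LHS](subnKC sF) -[RHS](subnKC sG); congr (_ + _).
have defG : G = redistribute i j (G i) F.
  apply/msetP => x; rewrite mset_ofE; case: eqVneq => [->//|xi].
  case: eqVneq => [->|xj]; first by rewrite eq_s addKn.
  have := congr1 (fun H : {mset 'I_n} => H x) eq_FG.
  by rewrite !redistribute_other.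
have eq_fib : fiber G =1 fiber F.
  by move=> b; rewrite /fiber {1}defG redistribute_twice // eq_s leq_addr.
have eq_Fi : F i = G i.
  apply: (@squeeze_inj (F i + F j) (fiber F)).
  - by rewrite inE leq_addr fiber_id.
  - by rewrite inE eq_s leq_addr -eq_fib fiber_id.
  - by rewrite eq_i -eq_s; apply: eq_squeeze.
by rewrite defG -eq_Fi redistribute_id.
Qed.

Lemma card_compression : #|` compression| = #|` FF|.
Proof. by rewrite card_in_imfset //; apply: compress_inj. Qed.

(** Compression fixes all coordinates other than i and j, so two fibers meet
    with a constant contribution there, and [squeeze_meet] handles the rest. *)
Lemma compression_family k t :
  is_t_int_family k t FF -> is_t_int_family k t compression.
Proof.
case/andP=> /allP FFk /allrelP meet; apply/andP; split.
  apply/allP => _ /imfsetP[/= F FFF ->].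
  by rewrite mcard_redistribute ?FFk ?squeeze_le ?leq_addr.
apply/allrelP => _ _ /imfsetP[/= F FFF ->] /imfsetP[/= G GFF ->].
rewrite mcard_meet_redistribute.
apply: squeeze_meet; rewrite ?leq_addr ?fiber_id // => a b _ _ Fa Gb.
by rewrite -mcard_meet_redistribute meet.
Qed.

Lemma leq_max_mult (GG : {fset {mset 'I_n}}) F x :
  F \in GG -> F x <= max_mult GG.
Proof.
move=> FGG; apply: (@leq_trans (\max_(y < n) F y)); first exact: leq_bigmax.
exact: (@leq_bigmax_seq _ _ _ (fun F : {mset 'I_n} => \max_(y < n) F y)).
Qed.

Lemma max_mult_compression : max_mult compression <= max_mult FF.
Proof.
apply/bigmax_leqP_seq => _ /imfsetP[/= F FFF ->] _.
apply/bigmax_leqP => x _; rewrite mset_ofE.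
have := leq_trans (squeeze_max (fiber F) (leq_addr (F j) (F i))) _.
move=> /(_ (max_mult FF)); rewrite addKn !geq_max !leq_max_mult //.
by case/(_ isT)/andP => le_i le_j; do 2 case: ifP => // _; exact: leq_max_mult.
Qed.

Definition sqr_sum F := \sum_x F x ^ 2.
Definition energy (GG : {fset {mset 'I_n}}) := \sum_(F <- GG) sqr_sum F.

Lemma sqr_sum_compress F : sqr_sum (compress F) <= sqr_sum F.
Proof.
have := squeeze_sqr (fiber F) (leq_addr (F j) (F i)).
rewrite /sqr_sum !big_split2 redistribute_l redistribute_r addKn => le_sq.
apply: leq_add => //; apply: eq_leq; apply: eq_bigr => x /andP[xi xj].
by rewrite redistribute_other.
Qed.

Lemma sqr_sum_compress_lt F : F j = 0 -> 1 < F i ->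
  redistribute i j 1 F \notin FF -> sqr_sum (compress F) < sqr_sum F.
Proof.
move=> Fj0 Fi_gt1 notFF.
have := @squeeze_sqr_lt (F i) (fiber F) Fi_gt1 notFF.
rewrite /sqr_sum !big_split2 redistribute_l redistribute_r Fj0 !addn0 => lt_sq.
rewrite -addSn leq_add //; apply: eq_leq; apply: eq_bigr => x /andP[xi xj].
by rewrite redistribute_other.
Qed.

Lemma energy_compression F : F \in FF -> F j = 0 -> 1 < F i ->
  redistribute i j 1 F \notin FF -> energy compression < energy FF.
Proof.
move=> FFF Fj0 Fi_gt1 notFF; rewrite /energy.
rewrite big_imfset /=; last exact: compress_inj.
rewrite (big_fsetD1 F) //= [ltnRHS](big_fsetD1 F) //=.
rewrite -addSn leq_add ?sqr_sum_compress_lt // leq_sum // => G _.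
exact: sqr_sum_compress.
Qed.

End Redistribute.

(** * Families of minimal energy have kernel M(n, 1) *)

Section Kernel.
Variables (n k t : nat).
Hypothesis le_n : 2 * k - t <= n.
Implicit Types (F G : {mset 'I_n}) (FF : {fset {mset 'I_n}}).

Lemma meet_M1E F G x :
  (F `&` G `&` Mset n 1) x = minn (minn (F x) (G x)) 1.
Proof. by rewrite !msetE2 MsetE. Qed.

(** Without an index of multiplicity at least 2 in both, F and G meet in a
    plain set, so M(n, 1) cuts nothing off. *)
Lemma heavy_index F G :
  mcard (F `&` G `&` Mset n 1) < mcard (F `&` G) ->
  exists i, 1 < F i /\ 1 < G i.
Proof.
move=> kern.
suff /existsP[i /andP[]] : [exists i, (1 < F i) && (1 < G i)] by exists i.
apply: contraLR kern => /existsPn light; rewrite -leqNgt leq_sum // => x _.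
rewrite meet_M1E msetE2; have := light x.
by move: (F x) (G x) => a b; lia.
Qed.

(** If F and G together covered every index, their multiset union would have
    at least n elements, and at least n + 1 because of index i; but it has
    2k - |F meet G| <= 2k - t <= n elements. *)
Lemma free_index F G i :
  mcard F = k -> mcard G = k -> t <= mcard (F `&` G) ->
  1 < F i -> 1 < G i -> exists j, F j = 0 /\ G j = 0.
Proof.
move=> Fk Gk meet Fi Gi.
suff /existsP[j /andP[/eqP Fj /eqP Gj]] : [exists j, (F j == 0) && (G j == 0)].
  by exists j.
apply: contraT => /existsPn full.
(* The summand (x == i) records the excess of the union at i. *)
have le_sum : \sum_x (minn (F x) (G x) + 1 + (x == i)) <= \sum_x (F x + G x).
  apply: leq_sum => x _; have := full x.
  have [-> _ | _] := eqVneq x i; first by move: (F i) (G i) Fi Gi => a b; lia.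
  by move: (F x) (G x) => a b; lia.
have one : \sum_x (x == i : nat) = 1.
  by rewrite (bigD1 i) //= eqxx big1 // => x /negPf->.
have ones : \sum_(x < n) 1 = n by rewrite sum1_card card_ord.
have defI : \sum_x minn (F x) (G x) = mcard (F `&` G).
  by apply: eq_bigr => x _; rewrite msetE2.
move: le_sum; rewrite !big_split /= one ones defI -/(mcard F) -/(mcard G) Fk Gk.
by move: (mcard _) meet => c; lia.
Qed.

(** When the value 1 already lies in the fiber of F, the multiset found there
    can take the place of F: it has the same common support with G but meets
    G in fewer elements. So the proof inducts on the size of the intersection
    until the value 1 is missing. *)
Lemma energy_descent FF F G :
  is_t_int_family k t FF -> F \in FF -> G \in FF ->
  mcard (F `&` G `&` Mset n 1) < t ->
  exists i j, i != j /\ energy (compression i j FF) < energy FF.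
Proof.
case/andP=> /allP FFk /allrelP meet.
have [m] := ubnP (mcard (F `&` G)); elim: m F => // m IHm F ltm FFF GFF kern.
have FGt := meet _ _ FFF GFF.
have [i [Fi Gi]] := heavy_index (leq_trans kern FGt).
have [j [Fj Gj]] := free_index (eqP (FFk _ FFF)) (eqP (FFk _ GFF)) FGt Fi Gi.
have neq_ij : i != j by apply: contraTneq Fi => ->; rewrite Fj.
have [F'FF | notFF] := boolP (redistribute i j 1 F \in FF); last first.
  by exists i, j; split=> //; apply: (energy_compression neq_ij FFF).
apply: (IHm (redistribute i j 1 F)) => //.
  apply: leq_trans (ltnSE ltm).
  rewrite /mcard !(big_split2 neq_ij) !msetE2.
  rewrite (redistribute_l i j) (redistribute_r neq_ij) Fj Gj !minn0 !addn0.
  rewrite -addSn leq_add //.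
    by move: (F i) (G i) Fi Gi => a b; lia.
  apply: eq_leq; apply: eq_bigr => x /andP[xi xj].
  by rewrite !msetE2 redistribute_other.
apply: leq_ltn_trans kern; apply: eq_leq; apply: eq_bigr => x _.
rewrite !meet_M1E mset_ofE; case: eqVneq => [->|_].
  by move: (F i) (G i) Fi Gi => a b; lia.
by case: eqVneq => // ->; rewrite Gj !minn0 !min0n.
Qed.

Lemma exists_kernel_family FF : is_t_int_family k t FF ->
  exists GG : {fset {mset 'I_n}}, [/\ is_t_int_family k t GG,
    #|` FF| = #|` GG|, t_kernel t (Mset n 1) GG & max_mult GG <= max_mult FF].
Proof.
have [m] := ubnP (energy FF); elim: m FF => // m IHm FF ltm FFt.
have [kern | ] := boolP (t_kernel t (Mset n 1) FF); first by exists FF.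
case/allPn => F FFF /allPn[G GFF]; rewrite -ltnNge => kern.
have [i [j [neq_ij lt_e]]] := energy_descent FFt FFF GFF kern.
have [] := IHm (compression i j FF); first exact: leq_trans lt_e (ltnSE ltm).
  exact: compression_family.
move=> GG [GGt cardGG kerGG maxGG]; exists GG; split=> //.
  by rewrite -cardGG card_compression.
by apply: leq_trans maxGG _; apply: max_mult_compression.
Qed.

End Kernel.

Theorem theorem1p7 (n k t : nat) :
  0 < n -> 0 < k -> 1 <= t <= k -> 2 * k - t <= n ->
  exists f : t_int_family n k t -> t_int_family n k t,
    forall FF : t_int_family n k t,
      [/\ #|` sval FF| = #|` sval (f FF)|,
          t_kernel t (Mset n 1) (sval (f FF))
        & max_mult (sval FF) >= max_mult (sval (f FF))].
Proof.
move=> _ _ _ le_n.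
have exf (FF : t_int_family n k t) : exists GG : t_int_family n k t,
  [&& #|` sval FF| == #|` sval GG|, t_kernel t (Mset n 1) (sval GG)
    & max_mult (sval GG) <= max_mult (sval FF)].
  have [GG [GGt cardGG kerGG maxGG]] := exists_kernel_family le_n (svalP FF).
  by exists (exist _ GG GGt); rewrite /= cardGG eqxx kerGG.
exists (fun FF => xchoose (exf FF)) => FF.
by have /and3P[/eqP] := xchooseP (exf FF).
Qed.
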